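(* Let $X$ be a locally compact Polish space and let $\sigma$ be a non-atomic Radon measure on $X$ with $\sigma(X)=\infty$. Let $\Lambda^{(n)}\in\mathscr B_0(X)$, $n\in\mathbb N$, be such that $\Lambda^{(1)}\subset\Lambda^{(2)}\subset\cdots$, $\bigcup_{n}\Lambda^{(n)}=X$, and set $V^{(n)}:=\sigma(\Lambda^{(n)})>0$ (so $V^{(n)}\to\infty$). Let $N^{(n)}\in\mathbb N$, $n\in\mathbb N$, be (deterministic) numbers with $$\lim_{n\to\infty}\frac{N^{(n)}}{V^{(n)}}=1 .$$ For each $n$, let $A(\Lambda^{(n)},N^{(n)};f)$, $f\in B_0(X)$, and $\tau_{\Lambda^{(n)},N^{(n)}}$ be the operators and the trace describing $N^{(n)}$ freely independent particles in $\Lambda^{(n)}$, each with distribution $\sigma^{(n)}=\frac1{V^{(n)}}\sigma$ on $\Lambda^{(n)}$. Let $A(f)$, $f\in B_0(X)$, and $\tau$ be the operators and the vacuum trace of the free Poisson process on $X$ with intensity measure $\sigma$. Then, for any $k\in\mathbb N$ and any $f_1,\dots,f_k\in B_0(X)$, $$\lim_{n\to\infty}\tau_{\Lambda^{(n)},N^{(n)}}\big(A(\Lambda^{(n)},N^{(n)};f_1)\cdots A(\Lambda^{(n)},N^{(n)};f_k)\big)=\tau\big(A(f_1)\cdots A(f_k)\big).$$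
   Context: $\mathscr B_0(X)$ is the collection of Borel subsets of $X$ with compact closure. A measure on the Borel $\sigma$-algebra of $X$ is Radon if it is finite on every set of $\mathscr B_0(X)$. $B_0(X)$ is the set of all bounded measurable functions $f:X\to\mathbb R$ with compact support. All Hilbert spaces are real. **Free Poisson process.** For a real separable Hilbert space $H$, the full Fock space is $\mathscr F(H)=\bigoplus_{n=0}^\infty H^{\otimes n}$, $H^{\otimes 0}=\mathbb R$, with vacuum $\Omega=(1,0,0,\dots)$. For $h\in H$, $a^+(h)$ is the bounded operator with $a^+(h)f^{(n)}=h\otimes f^{(n)}$ for $f^{(n)}\in H^{\otimes n}$, and $a^-(h)$ is its adjoint, so that $a^-(h)\Omega=0$ and $a^-(h)f_1\otimes\dots\otimes f_n=(h,f_1)_H f_2\otimes\dots\otimes f_n$. For a bounded operator $L$ in $H$, $a^0(L)\Omega=0$ and $a^0(L)f_1\otimes\dots\otimes f_n=(Lf_1)\otimes f_2\otimes\dots\otimes f_n$. The free Poisson process on $X$ with intensity $\sigma$ is the family of bounded selfadjoint operators in $\mathscr F(L^2(X,\sigma))$ $$A(f)=a^+(f)+a^0(f)+a^-(f)+\int_X f\,d\sigma,\qquad f\in B_0(X),$$ where in $a^0(f)$ the function $f$ is identified with the operator of multiplication by $f$. On the algebra generated by these operators, $\tau(a)=(a\Omega,\Omega)_{\mathscr F(L^2(X,\sigma))}$. **$N$ freely independent particles.** Let $\Lambda\in\mathscr B_0(X)$, let $P_\Lambda$ be a probability measure on $\Lambda$, and $N\in\mathbb N$. Functions $f\in B_0(X)$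 are restricted to $\Lambda$. Put $\langle f\rangle=\int_\Lambda f\,dP_\Lambda$ and $H=\{f\in L^2(\Lambda,P_\Lambda):\langle f\rangle=0\}$, and let $H_1,\dots,H_N$ be $N$ copies of $H$. Define $$\mathscr H(\Lambda,N)=\mathbb R\oplus\bigoplus_{\substack{k\in\mathbb N,\ l_1,\dots,l_k\in\{1,\dots,N\}\\ l_j\ne l_{j+1}}}H_{l_1}\otimes\dots\otimes H_{l_k},\qquad \Psi_N=(1,0,0,\dots).$$ For $g\in L^2(\Lambda,P_\Lambda)$ let $[g]_i:=g-\langle g\rangle\in H_i$. For $i\in\{1,\dots,N\}$ and $f\in B_0(X)$, $M_i(\Lambda;f)$ is the bounded linear operator in $\mathscr H(\Lambda,N)$ given by $M_i(\Lambda;f)\Psi_N=\langle f\rangle\Psi_N+[f]_i$ and, for $g_j\in H_{l_j}$ with $l_j\neq l_{j+1}$: if $i\ne l_1$, $M_i(\Lambda;f)g_1\otimes\dots\otimes g_k=\langle f\rangle g_1\otimes\dots\otimes g_k+[f]_i\otimes g_1\otimes\dots\otimes g_k$; if $i=l_1$, $M_i(\Lambda;f)g_1\otimes\dots\otimes g_k=\langle fg_1\rangle g_2\otimes\dots\otimes g_k+[fg_1]_i\otimes g_2\otimes\dots\otimes g_k$ (for $k=1$, $g_2\otimes\dots\otimes g_k$ means $\Psi_N$ in the first term and is absent in the second). This is the free product of $N$ copies of the algebra of multiplication operators in $L^2(\Lambda,P_\Lambda)$ with the state $f\mapsto\int_\Lambda f\,dP_\Lambda$. The particle system is given by $$A(\Lambda,N;f)=\sum_{i=1}^N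 M_i(\Lambda;f),\qquad \tau_{\Lambda,N}(a)=(a\Psi_N,\Psi_N)_{\mathscr H(\Lambda,N)} .$$ In the claim this is used with $\Lambda=\Lambda^{(n)}$, $N=N^{(n)}$, $P_\Lambda=\sigma^{(n)}$. *)

(* Defs.v *)
From HB Require Import structures.
From mathcomp Require Import all_boot all_order all_algebra.
From mathcomp Require Import all_classical all_reals all_analysis.

Set Implicit Arguments.
Unset Strict Implicit.
Unset Printing Implicit Defensive.

Import Order.TTheory GRing.Theory Num.Theory.
Import numFieldNormedType.Exports.

Local Open Scope classical_set_scope.
Local Open Scope ring_scope.

(* Real Hilbert spaces; completeness comes from [completeNormedModType]. *)
HB.mixin Record NormedModule_isHilbert (R : realType) V
    & CompleteNormedModule R V := {
  dot : V -> V -> R ;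
  dotC : forall u v, dot u v = dot v u ;
  dotP : forall (a : R) u v w, dot (a *: u + v) w = a * dot u w + dot v w ;
  dot_norm : forall v, dot v v = `|v| ^+ 2
}.

#[short(type="hilbertType")]
HB.structure Definition Hilbert (R : realType) :=
  { V of CompleteNormedModule R V & NormedModule_isHilbert R V }.

Section HilbertOperators.
Context {R : realType} {F : hilbertType R}.

Definition bounded_op (a : {linear F -> F}) : Prop :=
  exists C : R, forall v, `|a v| <= C * `|v|.

Definition adjoint_op (a b : F -> F) : Prop :=
  forall u v, dot (a u) v = dot u (b v).

Definition linear_span (S : set F) : set F :=
  [set v | exists n (c : 'I_n -> R) (e : 'I_n -> F),
     (forall i, S (e i)) /\ v = \sum_(i < n) c i *: e i].

Definition vector_state (xi : F) (a : F -> F) : R := dot (a xi) xi.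

Definition op_prod (s : seq (F -> F)) : F -> F := foldr comp id s.

End HilbertOperators.

Section L2.
Context {d} {T : measurableType d} {R : realType}.
Variable mu : {measure set T -> \bar R}.

Definition L2 : {pred T -> R} := Lfun mu 2%:E.

Definition mean (g : T -> R) : R := \int[mu]_x g x.

Definition L2dot (g h : T -> R) : R := \int[mu]_x (g x * h x).

Definition centering (g : T -> R) : T -> R := fun x => g x - mean g.

Definition L2word (s : seq (T -> R)) : bool := all [in L2] s.

(* The full Fock space over L^2(T, mu), determined up to unitary isomorphism:
   [fock_tens [:: g1; ...; gn]] is g1 (x) ... (x) gn in the n-th tensor power,
   distinct powers are orthogonal, and these vectors span a dense subspace.
   Vectors of L^2 are given by representatives; the inner product formula
   forces [fock_tens] to be multilinear and to respect a.e. equality. Its values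
   outside [L2word] are unconstrained. *)
Record full_fock := FullFock {
  fock_space :> hilbertType R ;
  fock_tens : seq (T -> R) -> fock_space ;
  dot_fock_tens : forall s t, L2word s -> L2word t ->
    dot (fock_tens s) (fock_tens t) =
      if size s == size t then \prod_(p <- zip s t) L2dot p.1 p.2 else 0 ;
  fock_tens_total : dense (linear_span [set fock_tens s | s in [set s | L2word s]])
}.

Definition fock_vacuum (F : full_fock) : F := fock_tens F [::].

Definition is_creation (F : full_fock) (h : T -> R) (a : {linear F -> F}) :=
  bounded_op a /\
  forall s, L2word s -> a (fock_tens F s) = fock_tens F (h :: s).

(* a^0(L), for an operator L of L^2 given on representatives. *)
Definition is_gauge (F : full_fock) (L : (T -> R) -> (T -> R))
    (a : {linear F -> F}) :=
  [/\ bounded_op a, a (fock_vacuum F) = 0 &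
      forall g s, g \in L2 -> L2word s ->
        a (fock_tens F (g :: s)) = fock_tens F (L g :: s)].

(* Labelled words (l_1, g_1) ... (l_k, g_k) with g_j in L^2, <g_j> = 0 and
   l_j != l_(j+1): they index the elementary tensors of the free product. *)
Definition reduced_word (N : nat) (w : seq ('I_N * (T -> R))) : bool :=
  all (fun p => (p.2 \in L2) && (mean p.2 == 0)) w
  && sorted (fun l m => l != m) (unzip1 w).

(* R (+) the orthogonal sum of the H_(l_1) (x) ... (x) H_(l_k), described in the
   same way; words with different label sequences lie in different summands. *)
Record free_product_space (N : nat) := FreeProductSpace {
  fps_space :> hilbertType R ;
  fps_tens : seq ('I_N * (T -> R)) -> fps_space ;
  dot_fps_tens : forall w z, reduced_word w -> reduced_word z ->
    dot (fps_tens w) (fps_tens z) =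
      if unzip1 w == unzip1 z
      then \prod_(p <- zip (unzip2 w) (unzip2 z)) L2dot p.1 p.2 else 0 ;
  fps_tens_total : dense (linear_span [set fps_tens w | w in [set w | reduced_word w]])
}.

Definition fps_vacuum (N : nat) (F : free_product_space N) : F :=
  fps_tens F [::].

Definition is_particle_op (N : nat) (F : free_product_space N) (i : 'I_N)
    (f : T -> R) (a : {linear F -> F}) :=
  [/\ bounded_op a,
      a (fps_vacuum F) =
        mean f *: fps_vacuum F + fps_tens F [:: (i, centering f)],
      forall l g w, reduced_word ((l, g) :: w) -> i != l ->
        a (fps_tens F ((l, g) :: w)) =
          mean f *: fps_tens F ((l, g) :: w)
          + fps_tens F [:: (i, centering f), (l, g) & w] &
      forall g w, reduced_word ((i, g) :: w) ->
        a (fps_tens F ((i, g) :: w)) =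
          mean (f \* g) *: fps_tens F w
          + fps_tens F ((i, centering (f \* g)) :: w)].

End L2.

Notation borel X := (g_sigma_algebraType (@open X)).

Section Topology.
Context {R : realType} {X : ptopologicalType}.

Definition polish : Prop :=
  (exists D : set X, countable D /\ dense D) /\
  exists dist : X -> X -> R,
    [/\ forall x y, (dist x y == 0) = (x == y),
        forall x y, dist x y = dist y x,
        forall x y z, dist x z <= dist x y + dist y z,
        forall x (A : set X), nbhs x A <->
          exists2 e : R, 0 < e & [set y | dist x y < e] `<=` A &
        forall u : nat -> X,
          (forall e : R, 0 < e -> exists n, forall i j,
             (n <= i)%N -> (n <= j)%N -> dist (u i) (u j) < e) ->
          exists l : X, u i @[i --> \oo] --> l].

Definition B0set (A : set (borel X)) : Prop :=
  measurable A /\ compact (closure (A : set X)).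

Definition radon (mu : {measure set (borel X) -> \bar R}) : Prop :=
  forall A, B0set A -> (mu A < +oo)%E.

Definition non_atomic (mu : {measure set (borel X) -> \bar R}) : Prop :=
  forall A, measurable A -> (0 < mu A)%E ->
    exists B, [/\ measurable B, B `<=` A, (0 < mu B)%E & (mu B < mu A)%E].

Definition B0fun (f : borel X -> R) : Prop :=
  [/\ measurable_fun setT f, exists C : R, forall x, `|f x| <= C &
      compact (closure ([set x | f x != 0] : set X))].

End Topology.
Arguments polish R X : clear implicits.

Section Models.
Context {R : realType} {X : ptopologicalType}.

Record free_poisson (sigma : {measure set (borel X) -> \bar R}) := FreePoisson {
  fp_fock :> full_fock sigma ;
  fp_create : (borel X -> R) -> {linear fp_fock -> fp_fock} ;
  fp_gauge : (borel X -> R) -> {linear fp_fock -> fp_fock} ;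
  fp_annih : (borel X -> R) -> {linear fp_fock -> fp_fock} ;
  fp_createP : forall h, h \in L2 sigma -> is_creation h (fp_create h) ;
  fp_annihP : forall h, h \in L2 sigma ->
    bounded_op (fp_annih h) /\ adjoint_op (fp_annih h) (fp_create h) ;
  fp_gaugeP : forall f, B0fun f -> is_gauge (fun g => f \* g) (fp_gauge f)
}.

Definition fp_op sigma (P : free_poisson sigma) (f : borel X -> R) : P -> P :=
  fun v => fp_create P f v + fp_gauge P f v + fp_annih P f v
           + (\int[sigma]_x f x) *: v.

Definition fp_tau sigma (P : free_poisson sigma) : (P -> P) -> R :=
  vector_state (fock_vacuum P).

(* The measure A |-> sigma(A n Lambda) / sigma(Lambda) on X. *)
Definition inv_volume (sigma : {measure set (borel X) -> \bar R})
    (L : set (borel X)) : {nonneg R} :=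
  NngNum (etrans (invr_ge0 (fine (sigma L))) (fine_ge0 (measure_ge0 sigma L))).

Definition particle_law (sigma : {measure set (borel X) -> \bar R})
    (L : set (borel X)) (mL : measurable L) :
    {measure set (borel X) -> \bar R} :=
  mscale (inv_volume sigma L) (mrestr sigma mL).

Lemma particle_law_setT (sigma : {measure set (borel X) -> \bar R})
    (L : set (borel X)) (mL : measurable L) :
  (0 < sigma L < +oo)%E -> particle_law sigma mL setT = 1%E.
Proof.
move=> /andP[L0 Loo]; have -> : particle_law sigma mL setT =
    ((fine (sigma L))^-1%:E * sigma (setT `&` L))%E by [].
rewrite setTI -[X in (_ * X)%E]fineK ?ge0_fin_numE ?measure_ge0//.
rewrite -EFinM mulVf//.
by rewrite gt_eqF// fine_gt0// L0 Loo.
Qed.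

(* L^2(Lambda, P_Lambda) is L^2(X, P), where P is P_Lambda seen as a measure on X
   carried by Lambda. *)
Record free_particles (P : {measure set (borel X) -> \bar R}) (N : nat) :=
  FreeParticles {
  part_fps :> free_product_space P N ;
  part_M : 'I_N -> (borel X -> R) -> {linear part_fps -> part_fps} ;
  part_MP : forall i f, B0fun f -> is_particle_op i f (part_M i f)
}.

Definition part_op P N (Q : free_particles P N) (f : borel X -> R) : Q -> Q :=
  fun v => \sum_(i < N) part_M Q i f v.

Definition part_tau P N (Q : free_particles P N) : (Q -> Q) -> R :=
  vector_state (fps_vacuum Q).

End Models.

Arguments fp_op {R X sigma} P f.
Arguments fp_tau {R X sigma} P a.
Arguments part_op {R X P N} Q f.
Arguments part_tau {R X P N} Q a.

(* Main.v *)
Require Import Defs.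
From HB Require Import structures.
From mathcomp Require Import all_boot all_order all_algebra.
From mathcomp Require Import all_classical all_reals all_analysis.
From mathcomp Require Import measurable_realfun ring.

Set Implicit Arguments.
Unset Strict Implicit.
Unset Printing Implicit Defensive.

Import Order.TTheory GRing.Theory Num.Theory.
Import numFieldNormedType.Exports.

Local Open Scope classical_set_scope.
Local Open Scope ring_scope.

(** Write <g> for the mean of [g] under the one-particle law, g° = g - <g>, and
    let Phi(g1, ..., gk) be the sum of g1° (x) ... (x) gk° over all admissible
    labellings of the k factors by particles ([label_sum]).  The total
    particle operator maps the span of these vectors into itself: with N
    particles,

      A(f) Phi(g, w) = (N - 1) <f> Phi(g, w) + Phi(f, g, w) + Phi(fg, w)
                       + c (<fg> - <f><g>) Phi(w) - <g> Phi(f, w),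

    where c is N or N - 1 ([particle_op_cons], [particle_op_vacuum]).  On the
    Fock space, splitting A(f) into its four parts gives

      A(f) (g (x) w) = (int f) g (x) w + f (x) g (x) w + fg (x) w + (int fg) w

    ([fp_op_cons], [fp_op_vacuum]).  As the volume V tends to infinity with
    N / V -> 1, the mean <f> = V^-1 int_Lambda f tends to 0 while N <f> tends to
    int f, by dominated convergence over the exhausting sets Lambda; so each
    coefficient of the first recursion tends to the one of the second, and the
    additional term with <g> disappears.  Both Phi(w) and w pair with the vacuum
    to 1 if w is empty and to 0 otherwise.  Induction on the number of
    operators, for all words w at once ([cvg_pairing]), therefore gives
    convergence of < A(f1) ... A(fk) Phi(w), vacuum >, and the theorem is the
    case of the empty word. *)

(** * Inner products and totality *)

Section Hilbert.
Context {R : realType} {F : hilbertType R}.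
Implicit Types (u v w : F) (a : R).

Lemma dotDl u v w : dot (u + v) w = dot u w + dot v w.
Proof. by rewrite -[u in LHS]scale1r dotP mul1r. Qed.

Lemma dot0l w : dot (0 : F) w = 0.
Proof. by apply: (addrI (dot 0 w)); rewrite -dotDl !addr0. Qed.

Lemma dotZl a u w : dot (a *: u) w = a * dot u w.
Proof. by rewrite -[a *: u]addr0 dotP dot0l addr0. Qed.

Lemma dotBl u v w : dot (u - v) w = dot u w - dot v w.
Proof. by rewrite dotDl -scaleN1r dotZl mulN1r. Qed.

Lemma dot_suml I (r : seq I) (P : pred I) (E : I -> F) w :
  dot (\sum_(i <- r | P i) E i) w = \sum_(i <- r | P i) dot (E i) w.
Proof.
by elim/big_rec2: _ => [|i x y _ <-]; [exact: dot0l | rewrite dotDl].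
Qed.

(** A vector [v] of the span within distance |u| of [u] would satisfy
    |u - v|^2 = |u|^2 + |v|^2 >= |u|^2. *)
Lemma eq0_of_dot_total (S : set F) u :
  dense (linear_span S) -> (forall e, S e -> dot u e = 0) -> u = 0.
Proof.
move=> dS uS; apply: contrapT => /eqP; rewrite -normr_gt0 => u0.
have [v [uv [n [c [e [Se vE]]]]]] :
    ball u `|u| `&` linear_span S !=set0.
  apply: dS; last exact: ball_open.
  by exists u; exact: ballxx.
have ev : dot u v = 0.
  rewrite dotC vE dot_suml big1// => i _.
  by rewrite dotZl dotC uS ?mulr0.
move: uv; rewrite -ball_normE /= -ltr_sqr ?nnegrE//.
rewrite -!dot_norm dotBl (dotC u) (dotC v) !dotBl (dotC v u) ev subr0 sub0r.
by rewrite opprK gtrDl dot_norm ltNge sqr_ge0.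
Qed.

Lemma op_prod_rcons (s : seq (F -> F)) b v :
  op_prod (rcons s b) v = op_prod s (b v).
Proof. by elim: s => //= c s IH; rewrite IH. Qed.

Lemma op_prod_linear I (A : I -> F -> F) (s : seq I) :
  (forall i, linear (A i)) -> linear (op_prod (map A s)).
Proof.
by move=> lA; elim: s => //= i s IH a u v; rewrite /= IH lA.
Qed.

Section DotLinear.
Variables (A : F -> F) (x : F).
Hypothesis lA : linear A.

Let L : {linear F -> F} := HB.pack A (GRing.isLinear.Build _ _ _ _ A lA).

Lemma dot_linearD u v : dot (A (u + v)) x = dot (A u) x + dot (A v) x.
Proof. by rewrite -dotDl -(linearD L). Qed.

Lemma dot_linearB u v : dot (A (u - v)) x = dot (A u) x - dot (A v) x.
Proof. by rewrite -dotBl -(linearB L). Qed.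

Lemma dot_linearZ a u : dot (A (a *: u)) x = a * dot (A u) x.
Proof. by rewrite -dotZl -(linearZ_LR L). Qed.

End DotLinear.

End Hilbert.

(** * Bounded functions under a probability measure *)

Section BoundedL2.
Context {d} {T : measurableType d} {R : realType}.
Variable mu : {measure set T -> \bar R}.

Definition bounded_measurable (g : T -> R) : Prop :=
  measurable_fun setT g /\ exists C : R, forall x, `|g x| <= C.

Lemma bounded_measurableM f g :
  bounded_measurable f -> bounded_measurable g -> bounded_measurable (f \* g).
Proof.
move=> [mf [C fC]] [mg [D gD]]; split; first exact: measurable_funM.
by exists (C * D) => x; rewrite normrM ler_pM.
Qed.

Lemma integrable_bounded (g : T -> R) (A : set T) :
  measurable A -> (mu A < +oo)%E -> bounded_measurable g ->
  mu.-integrable A (EFin \o g).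
Proof.
move=> mA Aoo [mg [C gC]]; apply: measurable_bounded_integrable => //.
  exact: measurable_funTS.
exists C; split; first exact: num_real.
by move=> y Cy x _ /=; rewrite (le_trans (gC x)) ?ltW.
Qed.

Lemma sqr_integrable_L2 (g : T -> R) :
  measurable_fun setT g -> mu.-integrable setT (EFin \o (g \* g)) ->
  g \in L2 mu.
Proof.
move=> mg /integrableP[_ igg]; rewrite inE; apply/andP; split; rewrite inE//=.
rewrite /finite_norm unlock poweR_lty//.
under eq_integral => x _ /= do rewrite powR_mulrn// -normrX expr2.
exact: igg.
Qed.

Lemma L2dot_subZ (a b h : T -> R) (k : R) :
  a \in L2 mu -> b \in L2 mu -> h \in L2 mu ->
  L2dot mu (fun x => a x - k * b x) h = L2dot mu a h - k * L2dot mu b h.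
Proof.
have prod_int u v : u \in L2 mu -> v \in L2 mu ->
    mu.-integrable setT (EFin \o (u \* v)).
  by move=> u2 v2; apply/Lfun1_integrable; exact: Lfun2_mul_Lfun1.
move=> a2 b2 h2; rewrite /L2dot -RintegralZl//; last exact: prod_int.
rewrite -RintegralB//; first last.
- rewrite (_ : _ \o _ = (fun x => k%:E * (b x * h x)%:E)%E).
    by apply: integrableZl => //; exact: prod_int.
  by apply/funext.
- exact: prod_int.
by apply: eq_Rintegral => x _; rewrite mulrBl mulrA.
Qed.

Section Probability.
Hypothesis mu1 : mu setT = 1%E.
Implicit Types f g : T -> R.

Let bounded_int g : bounded_measurable g -> mu.-integrable setT (EFin \o g).
Proof. by move=> bg; apply: integrable_bounded => //; rewrite mu1 ltry. Qed.

Lemma bounded_L2 g : bounded_measurable g -> g \in L2 mu.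
Proof.
move=> bg; apply: sqr_integrable_L2; first by case: bg.
by apply: bounded_int; exact: bounded_measurableM.
Qed.

Lemma bounded_measurable_subZ f g (k : R) :
  bounded_measurable f -> bounded_measurable g ->
  bounded_measurable (fun x => f x - k * g x).
Proof.
move=> [mf [C fC]] [mg [D gD]]; split.
  by apply: measurable_funB => //; exact: measurable_funM.
exists (C + `|k| * D) => x; rewrite (le_trans (ler_normB _ _))// lerD//.
by rewrite normrM ler_wpM2l.
Qed.

Lemma bounded_cst1 : bounded_measurable (cst 1).
Proof. by split=> //; exists 1 => x /=; rewrite normr1. Qed.

Lemma mean_subZ f g (k : R) :
  bounded_measurable f -> bounded_measurable g ->
  mean mu (fun x => f x - k * g x) = mean mu f - k * mean mu g.
Proof.
move=> bf bg; rewrite /mean -RintegralZl//; last exact: bounded_int.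
rewrite -RintegralB//; first exact: bounded_int.
rewrite (_ : _ \o _ = (fun x => k%:E * (g x)%:E)%E); last exact/funext.
by apply: integrableZl => //; exact: bounded_int.
Qed.

Lemma centeringE g : centering mu g = fun x => g x - mean mu g * cst 1 x.
Proof. by apply/funext => x; rewrite /centering /= mulr1. Qed.

Lemma mean_cst1 : mean mu (cst 1) = 1.
Proof. by rewrite /mean Rintegral_cst// mul1r mu1. Qed.

Lemma bounded_centering g :
  bounded_measurable g -> bounded_measurable (centering mu g).
Proof.
move=> bg; rewrite centeringE.
by apply: bounded_measurable_subZ => //; exact: bounded_cst1.
Qed.

Lemma mean_centering g : bounded_measurable g -> mean mu (centering mu g) = 0.
Proof.
move=> bg; rewrite centeringE mean_subZ//; last exact: bounded_cst1.
by rewrite mean_cst1 mulr1 subrr.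
Qed.

Let mulr_centering f g :
  f \* centering mu g = fun x => (f \* g) x - mean mu g * f x.
Proof.
by apply/funext => x; rewrite /centering /= mulrBr [_ * mean _ _]mulrC.
Qed.

Lemma mean_mulr_centering f g :
  bounded_measurable f -> bounded_measurable g ->
  mean mu (f \* centering mu g) = mean mu (f \* g) - mean mu f * mean mu g.
Proof.
move=> bf bg; rewrite mulr_centering mean_subZ//.
  by rewrite [mean _ g * _]mulrC.
exact: bounded_measurableM.
Qed.

Lemma centering_mulr_centering f g :
  bounded_measurable f -> bounded_measurable g ->
  centering mu (f \* centering mu g) =
    fun x => centering mu (f \* g) x - mean mu g * centering mu f x.
Proof.
move=> bf bg; apply/funext => x; rewrite {1}/centering mean_mulr_centering//.
by rewrite mulr_centering /centering /=; ring.
Qed.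

End Probability.
End BoundedL2.

(** * Compactly supported functions and the volume limit *)

Section CompactlySupported.
Context {R : realType} {X : ptopologicalType}.
Implicit Types (f g : borel X -> R).

Lemma measurable_closed (A : set X) : closed A -> measurable (A : set (borel X)).
Proof.
move=> cA; rewrite -[A]setCK; apply: measurableC.
by apply: sub_sigma_algebra; exact: closed_openC.
Qed.

Lemma B0fun_bounded f : B0fun f -> bounded_measurable f.
Proof. by case. Qed.

Lemma B0fun_mul f g : B0fun f -> B0fun g -> B0fun (f \* g).
Proof.
move=> Bf Bg.
have [mfg [C fgC]] := bounded_measurableM (B0fun_bounded Bf) (B0fun_bounded Bg).
split=> //; first by exists C.
case: Bf => _ _ cf; apply: (subclosed_compact _ cf); first exact: closed_closure.
apply: closure_subset => x /=; apply: contra_neq => /= ->.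
by rewrite mul0r.
Qed.

Variable sigma : {measure set (borel X) -> \bar R}.
Hypothesis sigma_radon : radon sigma.

Lemma B0fun_integrable f : B0fun f -> sigma.-integrable setT (EFin \o f).
Proof.
move=> Bf; set K : set (borel X) := closure [set x | f x != 0].
have mK : measurable K by apply: measurable_closed; exact: closed_closure.
have fK : f \_ K = f.
  apply/funext => x; rewrite patchE; case: ifPn => // xK.
  apply/esym/eqP/negP => /negP fx; move/negP: xK; apply; apply/mem_set.
  exact: (@subset_closure X).
have Koo : (sigma K < +oo)%E.
  apply: sigma_radon; split => //.
  by rewrite -(closure_id _).1; [case: Bf | exact: closed_closure].
have /(integrable_mkcond _ mK).1 :=
  integrable_bounded mK Koo (B0fun_bounded Bf).
by rewrite restrict_EFin fK.
Qed.

Lemma B0fun_L2 f : B0fun f -> f \in L2 sigma.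
Proof.
move=> Bf; apply: sqr_integrable_L2; first by case: Bf.
by apply: B0fun_integrable; exact: B0fun_mul.
Qed.

(** The law is carried by [L], where it is proportional to [sigma]. *)
Lemma mean_particle_law (L : set (borel X)) (mL : measurable L) f :
  (0 < sigma L < +oo)%E -> bounded_measurable f ->
  mean (particle_law sigma mL) f =
    (fine (sigma L))^-1 * \int[sigma]_(x in L) f x.
Proof.
move=> /andP[L0 Loo] bf.
set P := particle_law sigma mL.
have intPf : P.-integrable setT (EFin \o f).
  apply: integrable_bounded => //.
  by rewrite [X in (X < _)%E]particle_law_setT ?L0 ?Loo// ltry.
have PLC : P (~` L) = 0%E.
  have -> : P (~` L) = ((fine (sigma L))^-1%:E * sigma (~` L `&` L))%E by [].
  by rewrite setICl measure0 mule0.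
rewrite /mean /Rintegral (negligible_integral _ _ intPf PLC)//; last first.
  exact: measurableC.
rewrite setTD setCK (@eq_measure_integral _ _ _ _ (mscale (inv_volume sigma L) sigma)).
  have intf : sigma.-integrable L (EFin \o f) by exact: integrable_bounded.
  rewrite integralE !ge0_integral_mscale//; first last.
  - by apply: measurable_funepos; case/integrableP: intf.
  - by apply: measurable_funeneg; case/integrableP: intf.
  have ip : (\int[sigma]_(x in L) (EFin \o f)^\+ x \is a fin_num)%E.
    by apply: integrable_fin_num => //; exact: integrable_funepos.
  have im : (\int[sigma]_(x in L) (EFin \o f)^\- x \is a fin_num)%E.
    by apply: integrable_fin_num => //; exact: integrable_funeneg.
  rewrite [in RHS]integralE fineB ?fineM ?fin_numM//.
  by rewrite -mulrBr -fineB.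
move=> A mA AL; have -> : P A = ((fine (sigma L))^-1%:E * sigma (A `&` L))%E by [].
by rewrite (setIidl AL).
Qed.

(** Dominated convergence for the truncations of [f] to [L n], with bound
    |f|. *)
Lemma cvg_Rintegral_exhaust (L : nat -> set (borel X)) f :
  (forall n, measurable (L n)) -> (forall n, L n `<=` L n.+1) ->
  \bigcup_n L n = setT -> sigma.-integrable setT (EFin \o f) ->
  \int[sigma]_(x in L n) f x @[n --> \oo] --> \int[sigma]_x f x.
Proof.
move=> mL Lincr Lcover intf.
have mf : measurable_fun setT (EFin \o f) by case/integrableP: intf.
have Lmono : {homo L : n m / (n <= m)%N >-> n `<=` m}.
  exact: homo_leq (@subset_refl _) (@subset_trans _) Lincr.
have mfL n : measurable_fun setT ((EFin \o f) \_ (L n)).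
  by apply/(measurable_restrictT _ (mL n)); exact: measurable_funTS.
have fL_f : {ae sigma, forall x, setT x ->
    ((EFin \o f) \_ (L n)) x @[n --> \oo] --> (EFin \o f) x}.
  apply: aeW => x _; have [n _ Lnx] : (\bigcup_n L n) x by rewrite Lcover.
  apply: cvg_near_cst; exists n => // m /= nm.
  by rewrite patchE mem_set//; exact: Lmono Lnx.
have fL_le : {ae sigma, forall x n, setT x ->
    (`|((EFin \o f) \_ (L n)) x| <= (abse \o (EFin \o f)) x)%E}.
  apply: aeW => x n _; rewrite patchE.
  by case: ifPn => // _; rewrite -[point]/0%E abse0 abse_ge0.
have [_ _ H] := dominated_convergence measurableT mfL mf fL_f
  (integrable_abse intf) fL_le.
apply: fine_cvg; rewrite fineK; last exact: integrable_fin_num.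
by under eq_fun do rewrite integral_mkcond; exact: H.
Qed.

End CompactlySupported.

(** * The particle operators on sums over labellings *)

Section FreeProduct.
Context {d} {T : measurableType d} {R : realType}.
Variables (mu : {measure set T -> \bar R}) (N : nat).
Hypothesis mu1 : mu setT = 1%E.
Variable F : free_product_space mu N.
Implicit Types (f g : T -> R) (w : seq (T -> R)) (z : seq ('I_N * (T -> R))).

Definition fresh (i : 'I_N) z : bool := if z is (l, _) :: _ then i != l else true.

Lemma reduced_word_cons i g z :
  reduced_word mu ((i, g) :: z) =
    [&& (g \in L2 mu) && (mean mu g == 0), fresh i z & reduced_word mu z].
Proof.
case: z => [|[l h] z]; rewrite /reduced_word /= ?andbT//.
by rewrite andbACA -!andbA.
Qed.

Fixpoint labellings w : seq (seq ('I_N * (T -> R))) :=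
  if w is g :: w' then
    [seq (i, centering mu g) :: z | z <- labellings w', i <- enum (fresh^~ z)]
  else [:: [::]].

Definition label_sum w : F := \sum_(z <- labellings w) fps_tens F z.

Lemma label_sum_nil : label_sum [::] = fps_vacuum F.
Proof. by rewrite /label_sum /= big_seq1. Qed.

Lemma big_labellings_cons (V : nmodType) g w (E : seq ('I_N * (T -> R)) -> V) :
  \sum_(u <- labellings (g :: w)) E u =
    \sum_(z <- labellings w) \sum_(i | fresh i z) E ((i, centering mu g) :: z).
Proof.
by rewrite /= big_allpairs_dep; apply: eq_bigr => z _; rewrite big_enum.
Qed.

Lemma labellings_reduced w z :
  (forall g, g \in w -> bounded_measurable g) ->
  z \in labellings w -> reduced_word mu z.
Proof.
elim: w z => [|g w IH] z bw /=; first by rewrite inE => /eqP ->.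
have bg : bounded_measurable g by apply: bw; rewrite mem_head.
move=> /allpairsPdep[z' [i [z'w]]]; rewrite mem_enum => + ->.
rewrite unfold_in => iz'; rewrite reduced_word_cons iz' IH// ?andbT; last first.
  by move=> h hw; apply: bw; rewrite inE hw orbT.
rewrite mean_centering// eqxx andbT.
by apply: bounded_L2 => //; exact: bounded_centering.
Qed.

Lemma labellings_nilp w z : z \in labellings w -> nilp z = nilp w.
Proof.
case: w => [|g w] /=; first by rewrite inE => /eqP ->.
by move=> /allpairsPdep[z' [i [_ _ ->]]].
Qed.

Lemma dot_label_sum_vacuum w :
  (forall g, g \in w -> bounded_measurable g) ->
  dot (label_sum w) (fps_vacuum F) = (nilp w)%:R.
Proof.
move=> bw; case: w bw => [|g w] bw.
  by rewrite label_sum_nil dot_fps_tens//= big_nil.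
rewrite /label_sum dot_suml big_seq big1// => z zw.
rewrite dot_fps_tens//; last exact: labellings_reduced zw.
by case: z {zw} (labellings_nilp zw).
Qed.

(** The inner product formula is linear in the first letter, and the tensors it
    is tested against are total. *)
Lemma fps_tens_subZ i (a b : T -> R) (k : R) z :
  reduced_word mu ((i, a) :: z) -> reduced_word mu ((i, b) :: z) ->
  reduced_word mu ((i, fun x => a x - k * b x) :: z) ->
  fps_tens F ((i, fun x => a x - k * b x) :: z) =
    fps_tens F ((i, a) :: z) - k *: fps_tens F ((i, b) :: z).
Proof.
move=> ra rb rc; apply/eqP; rewrite -subr_eq0; apply/eqP.
apply: (eq0_of_dot_total (@fps_tens_total _ _ _ _ _ F)) => _ [y ry <-].
rewrite !dotBl dotZl !dot_fps_tens//=.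
case: ifPn => [|_]; last by rewrite mulr0 !subr0.
case: y ry => //= -[l h] y ry; rewrite !big_cons /=.
move: ra rb rc ry; rewrite !reduced_word_cons.
move=> /andP[/andP[a2 _] _] /andP[/andP[b2 _] _] _ /andP[/andP[h2 _] _] _.
by rewrite L2dot_subZ// mulrBl mulrA subrr.
Qed.

Section OneStep.
Variables (f : T -> R) (M : 'I_N -> {linear F -> F}).
Hypotheses (bf : bounded_measurable f) (fM : forall i, is_particle_op i f (M i)).

Let A (v : F) : F := \sum_(i < N) M i v.

Let A_sum I (r : seq I) (E : I -> F) :
  A (\sum_(j <- r) E j) = \sum_(j <- r) A (E j).
Proof.
by rewrite /A exchange_big; apply: eq_bigr => i _ /=; rewrite linear_sum.
Qed.

Let M_vacuum i :
  M i (fps_vacuum F) =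
    mean mu f *: fps_vacuum F + fps_tens F [:: (i, centering mu f)].
Proof. by case: (fM i). Qed.

Let M_other i l g z : reduced_word mu ((l, g) :: z) -> i != l ->
  M i (fps_tens F ((l, g) :: z)) =
    mean mu f *: fps_tens F ((l, g) :: z)
    + fps_tens F [:: (i, centering mu f), (l, g) & z].
Proof. by case: (fM i) => _ _ + _; exact. Qed.

Let M_same i g z : reduced_word mu ((i, g) :: z) ->
  M i (fps_tens F ((i, g) :: z)) =
    mean mu (f \* g) *: fps_tens F z
    + fps_tens F ((i, centering mu (f \* g)) :: z).
Proof. by case: (fM i) => _ _ _; exact. Qed.

Lemma particle_op_vacuum :
  A (label_sum [::]) =
    (N%:R * mean mu f) *: label_sum [::] + label_sum [:: f].
Proof.
rewrite label_sum_nil /label_sum big_labellings_cons /= big_seq1 /A.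
rewrite (eq_bigr _ (fun i _ => M_vacuum i)).
by rewrite big_split /= sumr_const card_ord -scaler_nat scalerA.
Qed.

(** The number of labels that may precede a labelling of [w]: one is excluded
    by its first letter, if there is one. *)
Definition choices w : nat := if nilp w then N else N.-1.

Lemma card_fresh w z : z \in labellings w -> #|fresh^~ z| = choices w.
Proof.
move=> zw; rewrite /choices -(labellings_nilp zw); case: z {zw} => [|[l h] z] /=.
  by rewrite card_ord.
by rewrite -[N in N.-1]card_ord -(cardC1 l); apply: eq_card => i.
Qed.

(** For a tensor whose first letter has label j, each of the N - 1 particles
    i != j multiplies by <f> and creates f°, while particle j replaces g° by
    f g°, whose mean <fg> - <f><g> annihilates the letter and whose centering is
    (fg)° - <g> f°.  When the first letter is annihilated, the sum over j
    counts the labels that could have stood before the remaining word. *)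
Lemma particle_op_cons g w :
  bounded_measurable g -> (forall h, h \in w -> bounded_measurable h) ->
  A (label_sum (g :: w)) =
    (N.-1%:R * mean mu f) *: label_sum (g :: w)
    + label_sum [:: f, g & w]
    + ((choices w)%:R * (mean mu (f \* g) - mean mu f * mean mu g))
        *: label_sum w
    + (label_sum (f \* g :: w) - mean mu g *: label_sum (f :: w)).
Proof.
move=> bg bw.
pose u j z := (j, centering mu g) :: z.
have red_cons j z h : bounded_measurable h -> z \in labellings w ->
    fresh j z -> reduced_word mu ((j, centering mu h) :: z).
  move=> bh zw jz; rewrite reduced_word_cons jz (labellings_reduced bw zw).
  rewrite mean_centering// eqxx !andbT bounded_L2//.
  exact: bounded_centering.
have bfg : bounded_measurable (f \* g) by exact: bounded_measurableM.
have step j z : z \in labellings w -> fresh j z -> A (fps_tens F (u j z)) =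
    (N.-1%:R * mean mu f) *: fps_tens F (u j z)
    + \sum_(i | fresh i (u j z)) fps_tens F ((i, centering mu f) :: u j z)
    + (mean mu (f \* g) - mean mu f * mean mu g) *: fps_tens F z
    + (fps_tens F ((j, centering mu (f \* g)) :: z)
       - mean mu g *: fps_tens F ((j, centering mu f) :: z)).
  move=> zw jz; have ru := red_cons _ _ _ bg zw jz.
  rewrite {1}/A (bigD1 j) //= addrC -!addrA.
  rewrite M_same; last exact: ru.
  rewrite [RHS]addrA; congr (_ + _).
    rewrite (eq_bigr _ (fun i ij => M_other ru ij)).
    rewrite big_split /= sumr_const -scaler_nat scalerA.
    by rewrite cardC1 card_ord.
  rewrite mean_mulr_centering//; congr (_ + _).
  rewrite centering_mulr_centering// fps_tens_subZ//; try exact: red_cons.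
  rewrite -centering_mulr_centering//; apply: red_cons => //.
  by apply: bounded_measurableM => //; exact: bounded_centering.
rewrite {1}/label_sum A_sum big_labellings_cons big_seq.
under eq_bigr => z zw do under eq_bigr => j jz do rewrite step//.
under eq_bigr => z zw do rewrite !big_split /= -scaler_sumr sumr_const
  (card_fresh zw) sumrN -scaler_sumr.
rewrite -big_seq !big_split /= sumrN -!scaler_sumr; congr (_ + _ + _ + _).
- by rewrite /label_sum big_labellings_cons.
- by rewrite /label_sum !big_labellings_cons.
- rewrite /label_sum scaler_sumr; apply: eq_bigr => z _.
  by rewrite -scaler_nat scalerA.
- by rewrite /label_sum !big_labellings_cons.
Qed.

End OneStep.
End FreeProduct.

(** * The free Poisson operators on elementary tensors *)

Section FreePoisson.
Context {R : realType} {X : ptopologicalType}.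
Variable sigma : {measure set (borel X) -> \bar R}.
Hypothesis sigma_radon : radon sigma.
Variable P : free_poisson sigma.
Implicit Types (f g : borel X -> R) (w : seq (borel X -> R)).

Let tens := fock_tens P.

(** The annihilation operator is given only as the adjoint of creation; its
    values follow by testing against the total family of tensors. *)
Lemma annihilation_tens h w : h \in L2 sigma -> L2word sigma w ->
  fp_annih P h (tens w) =
    if w is g :: w' then L2dot sigma g h *: tens w' else 0.
Proof.
move=> h2 w2; apply/eqP; rewrite -subr_eq0; apply/eqP.
apply: (eq0_of_dot_total (@fock_tens_total _ _ _ _ P)) => _ [t t2 <-].
have [_ crE] := fp_createP P h2; have [_ adj] := fp_annihP P h2.
rewrite dotBl adj crE// dot_fock_tens//=; last by rewrite h2.
case: w w2 => [_|g w /andP[_ w2]] /=; first by rewrite dot0l subr0.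
rewrite dotZl dot_fock_tens// eqSS; case: ifP => _; last by rewrite mulr0 subr0.
by rewrite big_cons subrr.
Qed.

Lemma B0fun_word w : (forall g, g \in w -> B0fun g) -> L2word sigma w.
Proof. by move=> Bw; apply/allP => g gw; apply: B0fun_L2 => //; exact: Bw. Qed.

Lemma fp_op_linear f : linear (fp_op P f).
Proof.
move=> a u v; rewrite /fp_op !linearP !scalerDr.
by do 3 (rewrite [RHS]addrACA; congr (_ + _)).
Qed.

Lemma fp_op_vacuum f : B0fun f ->
  fp_op P f (tens [::]) = mean sigma f *: tens [::] + tens [:: f].
Proof.
move=> Bf; have f2 := B0fun_L2 sigma_radon Bf; rewrite /fp_op.
have [_ crE] := fp_createP P f2; have [_ g0 _] := fp_gaugeP P Bf.
by rewrite crE// g0 annihilation_tens// !addr0 addrC.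
Qed.

Lemma fp_op_cons f g w : B0fun f -> (forall h, h \in g :: w -> B0fun h) ->
  fp_op P f (tens (g :: w)) =
    mean sigma f *: tens (g :: w) + tens [:: f, g & w]
    + mean sigma (f \* g) *: tens w + tens (f \* g :: w).
Proof.
move=> Bf Bgw; have f2 := B0fun_L2 sigma_radon Bf; rewrite /fp_op.
have gw2 := B0fun_word Bgw; have /andP[g2 w2] := gw2.
have [_ crE] := fp_createP P f2; have [_ _ gE] := fp_gaugeP P Bf.
rewrite crE// gE// annihilation_tens//.
rewrite (_ : L2dot sigma g f = mean sigma (f \* g)); last first.
  by apply: eq_Rintegral => x _ /=; rewrite mulrC.
by rewrite [LHS]addrC [RHS]addrAC -!addrA.
Qed.

End FreePoisson.

(** * The thermodynamic limit *)

Section Limit.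
Context {R : realType} {X : ptopologicalType}.
Variable sigma : {measure set (borel X) -> \bar R}.
Hypotheses (sigma_radon : radon sigma) (sigma_infty : sigma setT = +oo%E).
Variable Lambda : nat -> set (borel X).
Hypotheses (Lambda_B0 : forall n, B0set (Lambda n))
  (Lambda_incr : forall n, Lambda n `<=` Lambda n.+1)
  (Lambda_cover : \bigcup_n Lambda n = setT)
  (V_gt0 : forall n, (0 < sigma (Lambda n))%E).
Variable N : nat -> nat.
Hypotheses (N_gt0 : forall n, (0 < N n)%N)
  (N_V : (N n)%:R / fine (sigma (Lambda n)) @[n --> \oo] --> (1 : R)).
Variable Q : forall n,
  free_particles (particle_law sigma (proj1 (Lambda_B0 n))) (N n).
Variable P : free_poisson sigma.
Implicit Types (f g : borel X -> R) (fs w : seq (borel X -> R)).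

Let mLambda n : measurable (Lambda n). Proof. by case: (Lambda_B0 n). Qed.

Let V n : R := fine (sigma (Lambda n)).
Let law n := particle_law sigma (proj1 (Lambda_B0 n)).

Let V_fin n : (0 < sigma (Lambda n) < +oo)%E.
Proof. by rewrite V_gt0; exact: sigma_radon. Qed.

Let law_setT n : law n setT = 1%E.
Proof. exact: particle_law_setT. Qed.

(** V n tends to the measure of the union of the sets Lambda, which is
    infinite. *)
Lemma cvg_inv_volume : (V n)^-1 @[n --> \oo] --> (0 : R).
Proof.
apply/gtr0_cvgV0; first by apply: nearW => n; rewrite fine_gt0.
apply/cvgeryP; rewrite -sigma_infty -Lambda_cover.
have VE n : (V n)%:E = sigma (Lambda n).
  by rewrite fineK// ge0_fin_numE//; case/andP: (V_fin n).
under eq_fun do rewrite VE.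
apply: nondecreasing_cvg_mu => //; first exact: bigcup_measurable.
move=> n m nm; apply/subsetPset.
exact: (homo_leq (@subset_refl _) (@subset_trans _) Lambda_incr).
Qed.

Lemma cvg_mean f : B0fun f -> mean (law n) f @[n --> \oo] --> (0 : R).
Proof.
move=> Bf; under eq_fun do rewrite (mean_particle_law _ (V_fin _) (B0fun_bounded Bf)).
rewrite -(mul0r (\int[sigma]_x f x)); apply: cvgM; first exact: cvg_inv_volume.
by apply: cvg_Rintegral_exhaust => //; exact: B0fun_integrable.
Qed.

Lemma cvg_number_mean f : B0fun f ->
  (N n)%:R * mean (law n) f @[n --> \oo] --> mean sigma f.
Proof.
move=> Bf; under eq_fun do rewrite (mean_particle_law _ (V_fin _) (B0fun_bounded Bf)) mulrA.
rewrite -[mean sigma f]mul1r; apply: cvgM => //.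
by apply: cvg_Rintegral_exhaust => //; exact: B0fun_integrable.
Qed.

Lemma cvg_prednumber_mean f : B0fun f ->
  (N n).-1%:R * mean (law n) f @[n --> \oo] --> mean sigma f.
Proof.
move=> Bf.
under eq_fun => n do rewrite -subn1 natrB// mulrBl mul1r.
by rewrite -[mean sigma f]subr0; apply: cvgB;
  [exact: cvg_number_mean | exact: cvg_mean].
Qed.

Let Phi n w : Q n := label_sum (Q n) w.

Let part_op_linear n f : linear (part_op (Q n) f).
Proof.
move=> a u v; rewrite /part_op scaler_sumr -big_split /=.
by apply: eq_bigr => i _; rewrite linearP.
Qed.

Let part_op_vacuum n f : B0fun f ->
  part_op (Q n) f (Phi n [::]) =
    ((N n)%:R * mean (law n) f) *: Phi n [::] + Phi n [:: f].
Proof. by move=> Bf; apply: particle_op_vacuum => i; exact: part_MP. Qed.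

Let part_op_cons n f g w : B0fun f -> (forall h, h \in g :: w -> B0fun h) ->
  part_op (Q n) f (Phi n (g :: w)) =
    ((N n).-1%:R * mean (law n) f) *: Phi n (g :: w)
    + Phi n [:: f, g & w]
    + ((choices (N n) w)%:R
         * (mean (law n) (f \* g) - mean (law n) f * mean (law n) g)) *: Phi n w
    + (Phi n (f \* g :: w) - mean (law n) g *: Phi n (f :: w)).
Proof.
move=> Bf Bgw; apply: particle_op_cons.
- exact: law_setT.
- exact: B0fun_bounded.
- by move=> i; exact: part_MP.
- by apply: B0fun_bounded; apply: Bgw; rewrite mem_head.
- by move=> h hw; apply: B0fun_bounded; apply: Bgw; rewrite inE hw orbT.
Qed.

Let cvg_choices_mean w f : B0fun f ->
  (choices (N n) w)%:R * mean (law n) f @[n --> \oo] --> mean sigma f.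
Proof.
by move=> Bf; rewrite /choices; case: (nilp w);
  [exact: cvg_number_mean | exact: cvg_prednumber_mean].
Qed.

(** The operator next to the vector is expanded first, so the induction removes
    the last element of [fs] and has to range over all words [w]. *)
Lemma cvg_pairing fs w :
  (forall g, g \in fs -> B0fun g) -> (forall g, g \in w -> B0fun g) ->
  dot (op_prod (map (part_op (Q n)) fs) (Phi n w)) (fps_vacuum (Q n))
    @[n --> \oo] -->
  dot (op_prod (map (fp_op P) fs) (fock_tens P w)) (fock_vacuum P).
Proof.
elim/last_ind: fs w => [|fs f IH] w Bfs Bw /=.
  rewrite dot_fock_tens//; last exact: B0fun_word.
  apply: cvg_near_cst; apply: nearW => n.
  rewrite (dot_label_sum_vacuum (law_setT n)); last by move=> g /Bw /B0fun_bounded.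
  by case: w {Bw} => //=; rewrite big_nil.
have Bf : B0fun f by apply: Bfs; rewrite mem_rcons mem_head.
have Bfs' g : g \in fs -> B0fun g.
  by move=> gfs; apply: Bfs; rewrite mem_rcons inE gfs orbT.
have {}IH w' := IH w' Bfs'.
rewrite map_rcons op_prod_rcons.
under eq_fun do rewrite map_rcons op_prod_rcons.
have lP := op_prod_linear fs (@fp_op_linear _ _ _ P).
have lQ n := op_prod_linear fs (@part_op_linear n).
case: w Bw => [|g w] Bw.
  rewrite fp_op_vacuum// (dot_linearD _ lP) (dot_linearZ _ lP).
  under eq_fun do
    rewrite part_op_vacuum// (dot_linearD _ (lQ _)) (dot_linearZ _ (lQ _)).
  apply: cvgD; last by apply: IH => h; rewrite inE => /eqP ->.
  by apply: cvgM; [exact: cvg_number_mean | exact: IH].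
have Bg : B0fun g by apply: Bw; rewrite mem_head.
have B_cons h : B0fun h -> forall h', h' \in h :: w -> B0fun h'.
  move=> Bh h'; rewrite inE => /predU1P[->//|h'w].
  by apply: Bw; rewrite inE h'w orbT.
have Bfg : B0fun (f \* g) by exact: B0fun_mul.
rewrite fp_op_cons// 3!(dot_linearD _ lP) 2!(dot_linearZ _ lP).
under eq_fun do rewrite part_op_cons// (dot_linearD _ (lQ _))
  (dot_linearB _ (lQ _)) 2!(dot_linearD _ (lQ _)) 3!(dot_linearZ _ (lQ _)).
apply: cvgD; first apply: cvgD; first apply: cvgD.
- by apply: cvgM; [exact: cvg_prednumber_mean | exact: IH].
- by apply: IH => h; rewrite inE => /predU1P[->//|]; exact: Bw.
- apply: cvgM; last by apply: IH => h hw; apply: Bw; rewrite inE hw orbT.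
  (* N <f><g> = (N <f>) <g> vanishes, as only one mean absorbs the factor N. *)
  under eq_fun do rewrite mulrBr mulrA.
  rewrite -[mean sigma (f \* g)]subr0 -(mulr0 (mean sigma f)).
  by apply: cvgB; [|apply: cvgM; [|exact: cvg_mean]]; exact: cvg_choices_mean.
- set limit := dot (op_prod (map (fp_op P) fs) (fock_tens P (f \* g :: w))) _.
  rewrite -[limit]subr0 -(mul0r (dot
    (op_prod (map (fp_op P) fs) (fock_tens P (f :: w))) (fock_vacuum P))).
  apply: cvgB; first by apply: IH; exact: B_cons.
  by apply: cvgM; [exact: cvg_mean | apply: IH; exact: B_cons].
Qed.

End Limit.

Theorem theorem13 (R : realType) (X : ptopologicalType)
    (X_polish : polish R X) (X_lc : locally_compact [set: X])
    (sigma : {measure set (borel X) -> \bar R})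
    (sigma_radon : radon sigma) (sigma_na : non_atomic sigma)
    (sigma_infty : sigma setT = +oo%E)
    (Lambda : nat -> set (borel X)) (Lambda_B0 : forall n, B0set (Lambda n))
    (Lambda_incr : forall n, Lambda n `<=` Lambda n.+1)
    (Lambda_cover : \bigcup_n Lambda n = setT)
    (V_gt0 : forall n, (0 < sigma (Lambda n))%E)
    (N : nat -> nat) (N_gt0 : forall n, (0 < N n)%N)
    (N_V : (N n)%:R / fine (sigma (Lambda n)) @[n --> \oo] --> (1 : R))
    (Q : forall n,
       free_particles (particle_law sigma (proj1 (Lambda_B0 n))) (N n))
    (P : free_poisson sigma)
    (k : nat) (k_gt0 : (0 < k)%N)
    (f : 'I_k -> borel X -> R) (f_B0 : forall i, B0fun (f i)) :
  part_tau (Q n) (op_prod [seq part_op (Q n) (f i) | i : 'I_k]) @[n --> \oo] -->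
    fp_tau P (op_prod [seq fp_op P (f i) | i : 'I_k]).
Proof.
have f_in g : g \in [seq f i | i : 'I_k] -> B0fun g by move=> /mapP[i _ ->].
have nil_B0 g : g \in ([::] : seq (borel X -> R)) -> B0fun g by [].
have := cvg_pairing sigma_radon sigma_infty Lambda_incr Lambda_cover V_gt0 N_gt0
  N_V Q (P := P) f_in nil_B0.
rewrite -map_comp.
by under eq_fun do rewrite label_sum_nil -map_comp.
Qed.
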